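(* There exists a universal constant $C>0$ such that, for every hypergraph $H$ with $\mathsf{ghw}(H)\ge 9$, \[ \mathsf{subw}(H)\ge \frac{C}{\mathfrak R(H)}\cdot\frac{\mathsf{ghw}(H)}{\log \mathsf{ghw}(H)}. \]
   Context: Hypergraphs $H=(V,E)$ are finite, with $E\subseteq 2^V$, and have no isolated vertices. For a set of sets $X$, $\bigcup X$ is the union of its members ($\bigcup\emptyset=\emptyset$). $\mathbf 1\text{-}\mathsf{Sub}(H)$ is the set of functions $b:2^V\to\mathbb R_{\ge0}$ that are normalised ($b(\emptyset)=0$), monotone, submodular, and satisfy $b(X)\le 1$ for all $e\in E$, $X\subseteq e$. A tree decomposition of $H$ is a pair $(T,B)$ with $T$ a tree and $B:V(T)\to 2^V$ such that every $e\in E$ is contained in some $B(u)$ and, for every $v\in V$, the set $\{u: v\in B(u)\}$ is nonempty and connected in $T$. Put $\tau_b(H):=\min_{(T,B)}\max_{u\in V(T)}b(B(u))$. Submodular width: $\mathsf{subw}(H):=\sup_{b\in \mathbf 1\text{-}\mathsf{Sub}(H)}\tau_b(H)$. Generalised hypertree width: $\mathsf{ghw}(H):=\tau_b(H)$ where $b(U)$ is the edge cover number of $U$, i.e. the minimum number of edges of $H$ whose union contains $U$. For $F\subseteq E$, $\partial_H(F):=(\bigcup F)\cap(\bigcup(E\setminus F))$ and $\lambda_b(F):=b(\partial_H(F))$. $K^{\mathsf{Sub}}_{\mathbf 1}(H):=\{q\in\mathbb R_{\ge0}^{2^E}: \exists b\in\mathbf 1\text{-}\mathsf{Sub}(H)\text{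 with } q\le\lambda_b\text{ pointwise}\}$, and $\gamma_H^{\mathsf{Sub}}(q):=\inf\{\alpha\ge0: q\in\alpha\cdot K^{\mathsf{Sub}}_{\mathbf 1}(H)\}$ ($+\infty$ if no such $\alpha$). The line graph $M=P(H^* )$ has vertex set $E(H)$, with distinct $e,f$ adjacent iff $e\cap f\ne\emptyset$. For $\alpha:E(M)\to\mathbb R_{\ge0}$ and $F\subseteq E(H)$, $q_{M,\alpha}(F):=\sum\{\alpha_{xy}: xy\in E(M), x\in F, y\notin F\}$; $\alpha(\mathrm{Inc}_M(e))$ is the sum of $\alpha$ over the edges of $M$ incident with $e$. When $M$ has at least one edge (which is automatic if $\mathsf{ghw}(H)\ge 9$), the submodular gauge-routing ratio is \[ \mathfrak R(H):=\sup_{\alpha\ne0}\frac{\gamma_H^{\mathsf{Sub}}(q_{M,\alpha})}{\max_{e\in E(H)}\alpha(\mathrm{Inc}_M(e))}, \] the supremum being over all nonzero $\alpha:E(M)\to\mathbb R_{\ge0}$. *)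

(* Defs.v *)
From HB Require Import structures.
From mathcomp Require Import all_boot all_order all_algebra.

Set Implicit Arguments.
Unset Strict Implicit.
Unset Printing Implicit Defensive.

Import Order.TTheory GRing.Theory Num.Theory.

(* A hypergraph is given by its finite vertex type V and its edge set
   E : {set {set V}}.  Functions on 2^E are represented by functions on
   {set {set V}}, of which only the values at the subsets F of E matter. *)

Definition no_isolated (V : finType) (E : {set {set V}}) : Prop :=
  forall v : V, exists2 e, e \in E & v \in e.

(* As a is irreflexive, [ucycle a c] with [2 < size c] says that c is a
   simple graph cycle; c = [:: x; y] is only an edge traversed twice. *)
Definition is_tree (T : finType) (a : rel T) : Prop :=
  [/\ symmetric a, irreflexive a, 0 < #|T|,
      forall x y, connect a x y
    & forall c : seq T, ucycle a c -> size c <= 2].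

Definition induced_connected (T : finType) (a : rel T) (S : {set T}) : Prop :=
  {in S &, forall x y,
    connect [rel u w | [&& a u w, u \in S & w \in S]] x y}.

Definition tree_decomposition (V : finType) (E : {set {set V}})
    (T : finType) (a : rel T) (B : T -> {set V}) : Prop :=
  [/\ is_tree a,
      forall e, e \in E -> exists u, e \subset B u,
      forall v, exists u, v \in B u
    & forall v, induced_connected a [set u | v \in B u]].

(* If U is contained in the union of E, in particular for every U when there
   are no isolated vertices, the default value E satisfies the constraint. *)
Definition edge_cover_number (V : finType) (E : {set {set V}})
    (U : {set V}) : nat :=
  #|[arg min_(F < E | (F \subset E) && (U \subset cover F)) #|F|]|.

Definition boundary (V : finType) (E F : {set {set V}}) : {set V} :=
  cover F :&: cover (E :\: F).

(* Edges of the line graph, as unordered pairs of distinct hyperedges. *)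
Definition line_edges (V : finType) (E : {set {set V}}) :
    {set {set {set V}}} :=
  [set p | [exists e in E, exists f in E,
              [&& p == [set e; f], e != f & e :&: f != set0]]].

Definition separates (T : finType) (F p : {set T}) : bool :=
  [exists x in F, exists y in ~: F, p == [set x; y]].

From mathcomp Require Import all_classical all_reals all_analysis.

Local Open Scope classical_set_scope.
Local Open Scope ring_scope.

Definition one_Sub (R : realType) (V : finType) (E : {set {set V}}) :
    set ({set V} -> R) :=
  [set b | [/\ forall X, 0 <= b X,
               b finset.set0 = 0,
               forall X Y : {set V}, X \subset Y -> b X <= b Y,
               forall X Y : {set V}, b (X :|: Y) + b (X :&: Y) <= b X + b Y
             & forall e X : {set V}, e \in E -> X \subset e -> b X <= 1]].

(* Only used with b >= 0, so that 0 is neutral for the maximum. *)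
Definition width (R : realType) (V : finType) (b : {set V} -> R)
    (T : finType) (B : T -> {set V}) : R :=
  \big[Num.max/0]_(u : T) b (B u).

(* The set of widths is nonempty (a single bag) and finite (widths are
   values of b, or 0), so this infimum is a minimum. *)
Definition tau (R : realType) (V : finType) (E : {set {set V}})
    (b : {set V} -> R) : R :=
  inf [set w | exists (T : finType) (a : rel T) (B : T -> {set V}),
                 tree_decomposition E a B /\ w = width b B].

Definition subw (R : realType) (V : finType) (E : {set {set V}}) : \bar R :=
  ereal_sup [set (tau E b)%:E | b in @one_Sub R V E].

Definition ghw (R : realType) (V : finType) (E : {set {set V}}) : R :=
  tau E (fun U => (edge_cover_number E U)%:R).

Definition lambda (R : realType) (V : finType) (E : {set {set V}})
    (b : {set V} -> R) (F : {set {set V}}) : R :=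
  b (boundary E F).

Definition K_Sub (R : realType) (V : finType) (E : {set {set V}}) :
    set ({set {set V}} -> R) :=
  [set q | (forall F : {set {set V}}, F \subset E -> 0 <= q F) /\
           exists2 b, one_Sub E b &
             forall F : {set {set V}}, F \subset E -> q F <= lambda E b F].

Definition gauge_Sub (R : realType) (V : finType) (E : {set {set V}})
    (q : {set {set V}} -> R) : \bar R :=
  ereal_inf [set r%:E | r in
    [set r : R | 0 <= r /\
       exists2 k, K_Sub E k &
         forall F : {set {set V}}, F \subset E -> q F = r * k F]].

Definition cut_demand (R : realType) (V : finType) (E : {set {set V}})
    (alpha : {set {set V}} -> R) (F : {set {set V}}) : R :=
  \sum_(p in line_edges E | separates F p) alpha p.

Definition incident_weight (R : realType) (V : finType) (E : {set {set V}})
    (alpha : {set {set V}} -> R) (e : {set V}) : R :=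
  \sum_(p in line_edges E | e \in p) alpha p.

Definition line_weight (R : realType) (V : finType) (E : {set {set V}}) :
    set ({set {set V}} -> R) :=
  [set alpha | (forall p, p \in line_edges E -> 0 <= alpha p) /\
               exists2 p, p \in line_edges E & alpha p != 0].

(* The denominator is positive for every alpha in line_weight.  The supremum
   is taken over a nonempty set as soon as the line graph has an edge. *)
Definition routing_ratio (R : realType) (V : finType) (E : {set {set V}}) :
    \bar R :=
  ereal_sup [set (gauge_Sub E (cut_demand E alpha) /
                  (\big[Num.max/0]_(e in E) incident_weight E alpha e)%:E)%E
            | alpha in @line_weight R V E].

(* Main.v *)
(* The proof plays the tree decompositions of [H] against balanced cuts of its
   line graph.  Let [L] be about [ghw / 2], and call [F] balanced for a set [W]
   of [L] hyperedges if [F] and its complement each contain a third of [W].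

   If every such [W] has a separator of fewer than [L / 8] hyperedges leaving at
   most [7 L / 8] of [W] on each side, the Robertson-Seymour recursion yields a
   tree decomposition with bags covered by [9 L / 8 < ghw] hyperedges, which is
   absurd.  So some [W] has no such separator.

   For this [W], LP duality gives either weights [alpha] on the line graph, of
   load at most 1 at every hyperedge, for which all balanced cuts have weight at
   least [D = c L / log L], or a distribution on balanced cuts together with
   vertex costs [y] of total less than [D] with P(e, f separated) <= y e + y f
   on adjacent pairs.  In the second case the cut metric cannot have a small ball
   containing most of [W], and carving balls of well-chosen radius (region
   growing, which loses the factor [log L]) produces the forbidden separator.

   In the first case, the bag at a centroid of a tree decomposition contains the
   boundary of a balanced [F]; if the cut function of [alpha] is at most
   [r * lambda_b], this bag has [b]-value at least [D / r].  Hence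
   [subw >= D / gauge >= D / routing_ratio]. *)
Require Import Defs.
From HB Require Import structures.
From mathcomp Require Import all_boot all_order all_algebra.
From mathcomp Require Import reals.
From mathcomp Require Import ring lra zify.

Set Implicit Arguments.
Unset Strict Implicit.
Unset Printing Implicit Defensive.

Import Order.TTheory GRing.Theory Num.Theory.

(** * Balanced sets displayed by tree decompositions *)

Section BalancedNode.
Variables (T : finType) (a : rel T).
Hypothesis tree_a : is_tree a.

Let sym_a : symmetric a. Proof. by case: tree_a. Qed.

Definition avoiding (u : T) : rel T := [rel x y | [&& a x y, x != u & y != u]].

(** For [x != u] this is the component of [x] in the tree minus [u]. *)
Definition branch (u x : T) : {set T} := [set y | connect (avoiding u) x y].

Lemma avoiding_sym u : connect_sym (avoiding u).
Proof.
by apply: sym_connect_sym => x y; rewrite /avoiding /= sym_a [(x != u) && _]andbC.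
Qed.

Lemma branch_notin u x : x != u -> u \notin branch u x.
Proof.
move=> xu; rewrite inE; apply/negP => /connectP[p pp pu].
case: (lastP p) pp pu => [_ /= ux|q z]; first by rewrite ux eqxx in xu.
by rewrite rcons_path last_rcons => /andP[_ /and3P[_ _ /eqP zu]] /esym.
Qed.

Lemma branch_eq u x y : y \in branch u x -> branch u y = branch u x.
Proof.
rewrite inE => cxy; apply/setP => z; rewrite !inE.
by rewrite (same_connect (avoiding_sym u) cxy).
Qed.

(** Take the last node before a path from [x] first visits [u]. Branches at [u] can thus be named by
    neighbours of [u]. *)
Lemma branch_neighbour u x : x != u -> exists2 w, a u w & w \in branch u x.
Proof.
case: tree_a => _ _ _ /(_ x u)/connectP[p pp pu] _ xu.
elim: p x xu pp pu => [|z p IH] x xu /=; first by move=> _ xe; rewrite xe eqxx in xu.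
case/andP => axz pp pu; have [zu|zu] := eqVneq z u.
  by exists x; rewrite ?inE ?connect0 // sym_a -zu.
have [w auw wz] := IH z zu pp pu; exists w => //.
rewrite -(@branch_eq u x z) // inE; apply: connect1.
by rewrite /avoiding /= axz xu zu.
Qed.

(** A common node would give a walk from [w] to [u] that never uses the edge between them; with that
    edge it contains a cycle. *)
Lemma disjoint_branches u w : a u w -> [disjoint branch u w & branch w u].
Proof.
case: tree_a => _ irr _ _ acyc auw.
have uw : u != w by apply: contraTneq auw => ->; rewrite irr.
rewrite -setI_eq0; apply/eqP/setP => y; rewrite !inE; apply/negP => /andP[wy uy].
pose a' := [rel x z | a x z && ((x != u) || (z != w)) && ((x != w) || (z != u))].
have su : subrel (avoiding u) a'.
  by move=> x z /and3P[/= -> -> ->]; rewrite orbT.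
have sw : subrel (avoiding w) a'.
  by move=> x z /and3P[/= -> -> ->]; rewrite !orbT.
have cw : connect a' w y.
  by apply: connect_sub wy => x z /su; exact: connect1.
have cu : connect a' y u.
  rewrite avoiding_sym in uy.
  by apply: connect_sub uy => x z /sw; exact: connect1.
have /connectP[p pp pu] := connect_trans cw cu.
case: (shortenP pp) pu => q qq uq _ qu.
have /acyc : ucycle a (w :: q).
  rewrite /ucycle uq andbT /= rcons_path -qu auw andbT.
  by apply: sub_path qq => x z /andP[/andP[]].
case: q qq uq qu => [|v [|v' q]] //=.
  by move=> _ _ uwE; rewrite uwE eqxx in uw.
by move=> + _ uv _; rewrite -uv !eqxx /= andbF.
Qed.

Variables (N : finType) (W : {set N}) (pos : N -> T).

Let load (S : {set T}) := #|[set e in W | pos e \in S]|.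

(** Otherwise walk into the heavy branch each time. The heavy branch at the next node [w] cannot
    point back to [u], as two disjoint branches would each carry more than half of [W]; so heavy
    branches would shrink forever. *)
Lemma balanced_node :
  exists u, forall x, x != u -> 2 * load (branch u x) <= #|W|.
Proof.
have [/existsP[u /forallP uP]|] :=
    boolP [exists u, forall x, (x != u) ==> (2 * load (branch u x) <= #|W|)].
  by exists u => x; apply/implyP.
rewrite negb_exists => /forallP heavy; exfalso.
have {}heavy u : exists2 x, x != u & #|W| < 2 * load (branch u x).
  have := heavy u; rewrite negb_forall => /existsP[x].
  by rewrite negb_imply -ltnNge => /andP[]; exists x.
suff light n u x : #|branch u x| < n -> x != u -> 2 * load (branch u x) <= #|W|.
  case: tree_a => _ _ /card_gt0P[u _] _ _.
  have [x xu] := heavy u; rewrite ltnNge => /negP; apply.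
  exact: (light #|branch u x|.+1).
elim: n u x => // n IH u x small xu.
have [w auw wx] := branch_neighbour xu; rewrite -(branch_eq wx) in small *.
have [x' x'w big'] := heavy w.
have wu : w != u by apply: contraTneq wx => ->; exact: branch_notin.
have [ux'|ux'] := boolP (u \in branch w x').
  rewrite -(branch_eq ux') in big'.
  have : load (branch u w) + load (branch w u) <= #|W|.
    rewrite /load -cardsUI (_ : _ :&: _ = set0) ?cards0 ?addn0.
      by apply/subset_leq_card/subsetP => e; rewrite !inE => /orP[]/andP[].
    apply/setP => e; rewrite !inE; apply/negP => /andP[/andP[_ h1] /andP[_ h2]].
    have := disjoint_branches auw; rewrite disjoint_subset => /subsetP /(_ (pos e)).
    by rewrite !inE h1 h2 => /(_ isT).
  lia.
suff sub : branch w x' \subset branch u w :\ w.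
  suff small' : #|branch w x'| < n.
    by have := IH w x' small' x'w; rewrite leqNgt big'.
  apply: leq_ltn_trans (subset_leq_card sub) _.
  by rewrite (cardsD1 w (branch u w)) inE connect0 in small.
have [v awv vx'] := branch_neighbour x'w.
rewrite -(branch_eq vx') in ux' *.
have vu : v != u by apply: contraNneq ux' => <-; rewrite inE connect0.
have vw : v != w by apply: contraTneq vx' => ->; exact: branch_notin.
apply/subsetP => y yv; rewrite in_setD1.
have -> /= : y != w by apply: contraTneq yv => ->; exact: branch_notin.
rewrite -(@branch_eq u w v); last by rewrite inE connect1 // /avoiding /= awv wu vu.
(* A path from [v] avoiding [w] stays in [branch w v], which misses [u]; so it avoids [u] as
   well. *)
move: yv; rewrite !inE => /connectP[p pp ->].
have sp z : z \in p -> z != u.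
  move=> zp; apply: contraNneq ux' => <-; rewrite inE.
  by apply: (path_connect pp); rewrite inE zp orbT.
apply/connectP; exists p => //.
elim: p v {awv vx' ux' vw} vu pp sp => //= z p IHp v vu /andP[/and3P[avz _ _] pp] sp.
rewrite /avoiding /= avz vu sp ?mem_head //=; apply: IHp => // [|z' z'p].
  by rewrite sp ?mem_head.
by rewrite sp // inE z'p orbT.
Qed.

End BalancedNode.

Definition balanced (N : finType) (W F : {set N}) : bool :=
  (#|W| <= 3 * #|F :&: W|) && (#|W| <= 3 * #|W :\: F|).

(* A maximal union of classes with at most two thirds of [W] is balanced, unless
   adding one more class overshoots; then that class is balanced by itself. *)
Lemma balanced_union_of_classes (N : finType) (E W : {set N}) (cls : N -> {set N}) :
  W \subset E -> 0 < #|W| -> (forall e, e \in E -> e \in cls e /\ cls e \subset E) ->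
  (forall e f, f \in cls e -> cls f = cls e) ->
  (forall e, e \in E -> 2 * #|cls e :&: W| <= #|W|) ->
  exists F : {set N}, [/\ F \subset E, balanced W F
    & forall e, e \in F -> cls e \subset F].
Proof.
move=> WE W0 clsE cls_eq light.
pose ok (F : {set N}) := [&& F \subset E, [forall e in F, cls e \subset F]
   & 3 * #|F :&: W| <= 2 * #|W|].
have ok0 : ok set0.
  rewrite /ok sub0set set0I cards0 /=; apply/andP; split=> //.
  by apply/forall_inP => e; rewrite inE.
have cut (F : {set N}) : #|F :&: W| + #|W :\: F| = #|W|.
  by rewrite setIC cardsID.
case: (@arg_maxnP _ set0 ok (fun F => #|F :&: W|) ok0) => F /and3P[FE Fcl F23] Fmax.
have [Fbig|Fsmall] := leqP #|W| (3 * #|F :&: W|).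
  exists F; split=> //; last by move=> e eF; exact: (forall_inP Fcl).
  by rewrite /balanced Fbig /=; have := cut F; lia.
have [|[e]] := set_0Vmem (W :\: F).
  by move=> WF; have := cut F; rewrite WF cards0; lia.
rewrite inE => /andP[eF eW]; have eE := subsetP WE e eW.
have [ee clE] := clsE e eE; have le := light e eE.
have clcl f : f \in cls e -> cls f \subset cls e by move=> /cls_eq ->.
have [cbig|csmall] := leqP #|W| (3 * #|cls e :&: W|).
  by exists (cls e); split=> //; rewrite /balanced cbig /=; have := cut (cls e); lia.
have sz : #|(F :|: cls e) :&: W| <= #|F :&: W| + #|cls e :&: W|.
  by rewrite setIUl cardsU leq_subr.
have /Fmax /= : ok (F :|: cls e).
  rewrite /ok subUset FE clE /=; apply/andP; split; last by lia.
  apply/forall_inP => f; rewrite inE => /orP[fF|fc].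
    by apply: subset_trans (forall_inP Fcl f fF) _; exact: subsetUl.
  by apply: subset_trans (clcl f fc) _; exact: subsetUr.
rewrite leqNgt => /negP; case; apply: proper_card.
rewrite properE setSI ?subsetUl //=; apply/subsetPn; exists e.
  by rewrite !inE ee eW orbT.
by rewrite inE (negPf eF).
Qed.

(* The bag is that of a centroid: each branch there carries at most half of [W],
   and the boundary of a union of branches lies in the bag. *)
Lemma bag_contains_balanced_boundary (V : finType) (E W : {set {set V}})
    (T : finType) (a : rel T) (B : T -> {set V}) :
  tree_decomposition E a B -> W \subset E -> 1 < #|W| ->
  exists u (F : {set {set V}}),
    [/\ F \subset E, balanced W F & boundary E F \subset B u].
Proof.
move=> [tree_a cov _ conn] WE W1.
have [t0 _] : exists t, t \in T by case: tree_a => _ _ /card_gt0P.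
pose pos (e : {set V}) := odflt t0 [pick u | e \subset B u].
have posP e : e \in E -> e \subset B (pos e).
  move=> /cov[u eu]; rewrite /pos; case: pickP => //= none.
  by rewrite none in eu.
have [u light] := balanced_node tree_a W pos.
(* Hyperedges placed at [u] lie inside its bag, so each may form a class of its own. *)
pose cls (e : {set V}) := if pos e == u then [set e] else
  [set f in E | pos f \in branch a u (pos e)].
have pos_u e f : pos e != u -> pos f \in branch a u (pos e) -> pos f != u.
  by move=> eu; apply: contraTneq => ->; exact: branch_notin.
have [|e|e f|e|F [FE Fbal Fcl]] := @balanced_union_of_classes _ E W cls WE.
- exact: ltnW.
- move=> eE; rewrite /cls; case: ifP => _; first by rewrite inE eqxx sub1set.
  by rewrite inE eE inE connect0; split=> //; apply/subsetP => f; rewrite inE => /andP[].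
- rewrite /cls; case: (boolP (pos e == u)) => eu.
    by rewrite inE => /eqP ->; rewrite eu.
  by rewrite inE => /andP[fE fe]; rewrite (negPf (pos_u e f eu fe)) (branch_eq tree_a fe).
- rewrite /cls; case: (boolP (pos e == u)) => eu eE.
    have := subset_leq_card (subsetIl [set e] W); rewrite cards1.
    by move=> /(leq_mul (leqnn 2)) /leq_trans; apply.
  apply: leq_trans (light _ eu); rewrite leq_mul2l /=; apply/subset_leq_card/subsetP => f.
  by rewrite !inE => /andP[/andP[_ ->] ->].
exists u, F; split=> //; apply/subsetP => v; rewrite inE => /andP[/bigcupP[e eF ve]].
case/bigcupP => f; rewrite inE => /andP[fF fE] vf; have eE := subsetP FE e eF.
apply: contraR fF => vu.
have vpe : v \in B (pos e) by exact: subsetP (posP e eE) v ve.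
have vpf : v \in B (pos f) by exact: subsetP (posP f fE) v vf.
have peu : pos e != u by apply: contraNneq vu => <-.
apply: (subsetP (Fcl e eF)); rewrite /cls (negPf peu) inE fE inE /=.
(* Bags containing [v] link [pos e] to [pos f] and avoid [u], so [f] is in the class of [e], hence
   in [F]. *)
have /connect_sub : connect [rel x w | [&& a x w, x \in [set x | v \in B x]
     & w \in [set x | v \in B x]]] (pos e) (pos f) by apply: conn; rewrite inE.
apply=> x w /and3P[axw]; rewrite !inE => vx vw; apply: connect1.
by rewrite /avoiding /= axw /=; apply/andP; split; apply: contraNneq vu => <-.
Qed.

(** * Building tree decompositions from separators *)

Section RootedTree.
Variables (T : finType) (root : T) (par : T -> T) (h : T -> nat).
Hypothesis h_par : forall x, x != root -> h (par x) < h x.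

(** The guards exclude the root, where [par] may take any value. *)
Definition parent_rel : rel T :=
  [rel x y | (x != root) && (y == par x) || (y != root) && (x == par y)].

Lemma parent_rel_sym : symmetric parent_rel.
Proof. by move=> x y; rewrite /parent_rel /= orbC. Qed.

Lemma parent_rel_tree : is_tree parent_rel.
Proof.
have par_neq x : x != root -> x != par x.
  by move=> /h_par; apply: contraTneq => {2}->; rewrite ltnn.
split; first exact: parent_rel_sym.
- by move=> x; rewrite /parent_rel /= orbb; apply/negP => /andP[/par_neq/negP].
- by apply/card_gt0P; exists root.
- suff to_root n x : h x < n -> connect parent_rel x root.
    move=> x y; apply: connect_trans (to_root (h x).+1 x _) _ => //.
    by rewrite (sym_connect_sym parent_rel_sym) (to_root (h y).+1).
  elim: n x => // n IH x hx; have [->|xr] := eqVneq x root; first exact: connect0.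
  apply: (connect_trans (connect1 _) (IH (par x) _)).
    by rewrite /parent_rel /= xr eqxx.
  exact: leq_trans (h_par xr) _.
(* In a cycle, both neighbours of a node of maximal height are its parent. *)
move=> c cyc; rewrite leqNgt; apply/negP => c2.
have [x0 x0c] : exists x, x \in c by case: c c2 {cyc} => // x c _; exists x; rewrite mem_head.
case: (@arg_maxnP _ x0 (mem c) h x0c) => x xc xmax.
have up z : z \in c -> parent_rel x z -> z = par x.
  move=> /xmax /= hz /orP[/andP[_ /eqP //]|/andP[/h_par + /eqP xz]].
  by rewrite -xz ltnNge hz.
case/rot_to: (xc) => i p pE.
have : ucycle parent_rel (x :: p) by rewrite -pE rot_ucycle.
have sz : size (x :: p) = size c by rewrite -pE size_rot.
have inc z : z \in p -> z \in c by move=> zp; rewrite -(mem_rot i) pE inE zp orbT.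
case: p {pE} sz inc => [|z1 p] /= sz inc; first by rewrite -sz in c2.
case: (lastP p) sz inc => [|q z2] sz inc; first by rewrite -sz in c2.
rewrite /ucycle /= rcons_path last_rcons => /andP[/and3P[xz1 _ z2x] /and3P[_ + _]].
have z1E : z1 = par x by apply: up => //; rewrite inc ?mem_head.
have z2E : z2 = par x.
  apply: up; last by rewrite parent_rel_sym.
  by rewrite inc // inE mem_rcons mem_head orbT.
by rewrite z1E z2E mem_rcons mem_head.
Qed.

(** Climbing from a member of [S] stays in [S] and can only end at [t], so all members are linked
    through [t]. *)
Lemma parent_rel_induced (S : {set T}) t :
  (forall x, x \in S -> x = t \/ x != root /\ par x \in S) ->
  induced_connected parent_rel S.
Proof.
move=> top.
pose r := [rel u w | [&& parent_rel u w, u \in S & w \in S]].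
have r_sym : symmetric r.
  by move=> x y; rewrite /r /= parent_rel_sym [(x \in S) && _]andbC.
suff to_top n x : h x < n -> x \in S -> connect r x t.
  move=> x y xS yS; apply: connect_trans (to_top (h x).+1 x _ _) _ => //.
  by rewrite (sym_connect_sym r_sym) (to_top (h y).+1).
elim: n x => // n IH x hx xS.
have [->|[xr pxS]] := top x xS; first exact: connect0.
apply: (connect_trans (connect1 _) (IH (par x) _ pxS)).
  by rewrite /r /parent_rel /= xr eqxx xS pxS.
exact: leq_trans (h_par xr) _.
Qed.

End RootedTree.

(* A rooted tree decomposition of the subhypergraph [X], with bags recorded by
   covering sets of at most [m] hyperedges and [Z] inside the root bag; the
   nodes containing a vertex form a subtree with topmost node [t]. *)
Definition rooted_decomposition (V : finType) (X Z : {set {set V}}) (m : nat) : Prop :=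
  exists (T : finType) (root : T) (par : T -> T) (h : T -> nat)
         (bag : T -> {set {set V}}),
  [/\ forall x, x != root -> h (par x) < h x,
      forall x, bag x \subset X /\ #|bag x| <= m,
      forall e, e \in X -> exists x, e \in bag x,
      forall v, exists t, forall x, v \in cover (bag x) ->
        x = t \/ x != root /\ v \in cover (bag (par x))
    & Z \subset bag root].

Lemma rooted_decomposition_single (V : finType) (X : {set {set V}}) m :
  #|X| <= m -> rooted_decomposition X X m.
Proof.
move=> Xm; exists unit, tt, id, (fun=> 0), (fun=> X); split=> //.
by move=> v; exists tt; case; left.
Qed.

Lemma rooted_decomposition_sub (V : finType) (X Z Z' : {set {set V}}) m :
  Z' \subset Z -> rooted_decomposition X Z m -> rooted_decomposition X Z' m.
Proof.
move=> Z'Z [T [root [par [h [bag [h1 h2 h3 h4 h5]]]]]].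
exists T, root, par, h, bag; split=> //; exact: subset_trans h5.
Qed.

Lemma coverS (V : finType) (X Y : {set {set V}}) :
  X \subset Y -> cover X \subset cover Y.
Proof.
move=> XY; apply/bigcupsP => e eX; apply: bigcup_max (subsetP XY e eX) _.
exact: subxx.
Qed.

(** The second root becomes a child of the first. A vertex of both parts lies in both root bags, so
    its two subtrees join there. *)
Lemma rooted_decomposition_glue (V : finType) (X1 X2 Z1 Z2 : {set {set V}}) m :
  rooted_decomposition X1 Z1 m -> rooted_decomposition X2 Z2 m ->
  cover X1 :&: cover X2 \subset cover Z1 :&: cover Z2 ->
  rooted_decomposition (X1 :|: X2) Z1 m.
Proof.
move=> [T1 [r1 [p1 [h1 [b1 [hp1 sub1 cov1 top1 Zb1]]]]]].
move=> [T2 [r2 [p2 [h2 [b2 [hp2 sub2 cov2 top2 Zb2]]]]]] sep.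
pose M := \max_(x : T1) h1 x.
pose par (x : T1 + T2) : T1 + T2 :=
  match x with inl x => inl (p1 x)
  | inr x => if x == r2 then inl r1 else inr (p2 x) end.
pose h (x : T1 + T2) := match x with inl x => h1 x | inr x => (h2 x + M).+1 end.
pose bag (x : T1 + T2) := match x with inl x => b1 x | inr x => b2 x end.
exists (T1 + T2)%type, (inl r1), par, h, bag; split=> //.
- case=> x /= xr; first exact: hp1.
  case: eqP => [_|/eqP /hp2] /=; last by rewrite ltnS ltn_add2r.
  by rewrite ltnS (leq_trans (leq_bigmax r1)) // leq_addl.
- case=> x /=; [have [s ?] := sub1 x|have [s ?] := sub2 x]; split=> //.
    by apply: subset_trans s _; exact: subsetUl.
  by apply: subset_trans s _; exact: subsetUr.
- move=> e; rewrite inE => /orP[/cov1[x ex]|/cov2[x ex]].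
    by exists (inl x).
  by exists (inr x).
move=> v; have [t1 t1P] := top1 v; have [t2 t2P] := top2 v.
have [vX1|vX1] := boolP (v \in cover X1).
  exists (inl t1); case=> x /= vx; first by have [->|[? ?]] := t1P x vx; [left|right].
  right; split=> //.
  have /(subsetP sep) : v \in cover X1 :&: cover X2.
    by rewrite inE vX1; exact: subsetP (coverS (sub2 x).1) v vx.
  rewrite inE => /andP[vZ1 vZ2].
  have [xr|xr] /= := eqVneq x r2; first exact: subsetP (coverS Zb1) v vZ1.
  (* As [v] is in the bag of [r2], its topmost node [t2] can only be [r2]. *)
  have [xt|[]//] := t2P x vx.
  have := subsetP (coverS Zb2) v vZ2 => /t2P[rt|[]]; last by rewrite eqxx.
  by rewrite xt rt eqxx in xr.
exists (inr t2); case=> x /= vx.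
  by have := subsetP (coverS (sub1 x).1) v vx; rewrite (negPf vX1).
have [->|[xr ?]] := t2P x vx; first by left.
by right; split=> //; rewrite (negPf xr).
Qed.

Lemma rooted_decomposition_tree (V : finType) (E Z : {set {set V}}) m :
  no_isolated E -> rooted_decomposition E Z m ->
  exists (T : finType) (a : rel T) (bag : T -> {set {set V}}),
    tree_decomposition E a (fun u => cover (bag u)) /\
    forall u, bag u \subset E /\ #|bag u| <= m.
Proof.
move=> niso [T [root [par [h [bag [hp sub cov top _]]]]]].
exists T, (parent_rel root par), bag; split=> //; split.
- exact: parent_rel_tree hp.
- move=> e /cov[u eu]; exists u; exact: bigcup_max eu _.
- move=> v; have [e eE ve] := niso v; have [u eu] := cov e eE.
  by exists u; apply/bigcupP; exists e.
move=> v; have [t tP] := top v.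
refine (@parent_rel_induced _ root par h hp _ t _) => x.
by rewrite !inE => /tP.
Qed.

(** * The Robertson-Seymour recursion *)

Section BalancedSeparators.
Variables (V : finType) (E : {set {set V}}) (L : nat).

(* The Robertson-Seymour recursion: a boundary [Z] of size [L] is split by a
   separator, so that each side again has a boundary of size at most [L]. *)
Hypothesis separator : forall W : {set {set V}}, W \subset E -> #|W| = L ->
  exists A S B : {set {set V}},
  [/\ A :|: S :|: B = E, [disjoint A & S] && [disjoint A :|: S & B],
      {in A & B, forall e f, e :&: f = set0}, 8 * #|S| < L &
      (8 * #|A :&: W| <= 7 * L) && (8 * #|B :&: W| <= 7 * L)].

(** Induction on [#|X|]. [Z] is padded to size [L] and separated; the root bag, made of [Z'] and the
    separator, has fewer than 9L/8 hyperedges, and each side gets a boundary of fewer than 7L/8 +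
    L/8. *)
Lemma rooted_decomposition_separators m (X Z : {set {set V}}) :
  9 * L <= 8 * m -> X \subset E -> Z \subset X -> #|Z| <= L ->
  rooted_decomposition X Z m.
Proof.
move=> Lm.
elim: {X}#|X|.+1 {-2}X (ltnSn #|X|) Z => // n IH X Xn Z XE ZX ZL.
have [XL|LX] := leqP #|X| L.
  apply: (rooted_decomposition_sub ZX).
  by apply: rooted_decomposition_single; lia.
have [Z' [ZZ' Z'X Z'L]] : exists Z' : {set {set V}}, [/\ Z \subset Z', Z' \subset X & #|Z'| = L].
  have : exists k, k = L - #|Z| by exists (L - #|Z|).
  case=> k; elim: k Z ZX ZL => [|k IHk] Z ZX ZL kE.
    by exists Z; split=> //; lia.
  have [XZ|[e]] := set_0Vmem (X :\: Z).
    have := subset_leq_card ZX; have := cardsID Z X.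
    by rewrite XZ cards0 (setIidPr ZX); lia.
  rewrite inE => /andP[eZ eX].
  have [|||Z' [s1 s2 s3]] := IHk (e |: Z).
  - by rewrite subUset sub1set eX.
  - by rewrite cardsU1 eZ; lia.
  - by rewrite cardsU1 eZ; lia.
  exists Z'; split=> //; apply: subset_trans s1; exact: subsetUr.
have [A [S [B [ASB /andP[dAS dB] noAB SL /andP[AZ BZ]]]]] :=
  separator (subset_trans Z'X XE) Z'L.
have dAB e : e \in A -> e \notin B.
  move=> eA; move: dB; rewrite disjoint_subset => /subsetP /(_ e).
  by rewrite !inE eA => ->.
pose S' := S :&: X.
have cS' : #|S'| <= #|S| by rewrite subset_leq_card // subsetIl.
(* [S'] and one side together contain fewer than [L] elements of [Z'], so each side meets [Z'] and
   both recursive calls are on smaller sets. *)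
have cZ : L <= #|A :&: Z'| + #|S'| + #|B :&: Z'|.
  rewrite -Z'L; apply: (@leq_trans #|(A :&: Z') :|: S' :|: (B :&: Z')|).
    apply: subset_leq_card; apply/subsetP => e eZ'.
    have := subsetP (subset_trans Z'X XE) e eZ'; rewrite -ASB !inE eZ'.
    by rewrite (subsetP Z'X e eZ') !andbT.
  rewrite cardsU; apply: leq_trans (leq_subr _ _) _; rewrite leq_add2r.
  by rewrite cardsU leq_subr.
have side C : #|C :&: Z'| + #|S'| <= L -> ~~ (X \subset C :|: S) ->
    rooted_decomposition ((C :|: S) :&: X) (C :&: Z' :|: S') m.
  move=> CL nX; apply: IH.
  - rewrite -ltnS; apply: leq_trans Xn; rewrite ltnS; apply: proper_card.
    by rewrite properE subsetIr subsetI subxx andbT.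
  - by apply: subset_trans XE; exact: subsetIr.
  - by rewrite setIUl setUSS // setIS.
  - by rewrite cardsU; apply: leq_trans (leq_subr _ _) _.
have nonempty C : 0 < #|C :&: Z'| -> exists2 e, e \in C & e \in X.
  by case/card_gt0P => e; rewrite inE => /andP[eC /(subsetP Z'X)]; exists e.
have notin e : e \in B -> e \notin A :|: S.
  by move=> eB; apply: contraL eB => eAS; move: dB; rewrite disjoint_subset => /subsetP /(_ e eAS).
have dA : rooted_decomposition ((A :|: S) :&: X) (A :&: Z' :|: S') m.
  apply: side; first by lia.
  have [|e eB eX] := nonempty B; first by lia.
  by apply/subsetPn; exists e => //; exact: notin.
have dBX : rooted_decomposition ((B :|: S) :&: X) (B :&: Z' :|: S') m.
  apply: side; first by lia.
  have [|e eA eX] := nonempty A; first by lia.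
  apply/subsetPn; exists e => //; rewrite inE negb_or dAB //=.
  by move: dAS; rewrite disjoint_subset => /subsetP /(_ e eA).
have droot : rooted_decomposition (Z' :|: S') (Z' :|: S') m.
  by apply: rooted_decomposition_single; rewrite cardsU; lia.
have trisect e : e \in X -> [|| e \in A, e \in S | e \in B].
  by move=> /(subsetP XE); rewrite -ASB !inE -orbA.
have inZ e : e \in Z' -> e \in X by exact: (subsetP Z'X).
have cross v e f : e \in A -> f \in B -> v \in e -> v \notin f.
  move=> eA fB ve; apply/negP => vf; have /setP /(_ v) := noAB e f eA fB.
  by rewrite !inE ve vf.
have cov v (Y : {set {set V}}) e : e \in Y -> v \in e -> v \in cover Y.
  by move=> eY ve; apply/bigcupP; exists e.
have -> : X = ((Z' :|: S') :|: ((A :|: S) :&: X)) :|: ((B :|: S) :&: X).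
  apply/setP => e; rewrite !inE.
  have /implyP := trisect e; have /implyP := inZ e.
  by case: (e \in X); case: (e \in A); case: (e \in S); case: (e \in B); case: (e \in Z').
apply: (@rooted_decomposition_sub _ _ (Z' :|: S')).
  by apply: subset_trans ZZ' _; exact: subsetUl.
(* Both sides hang from the root bag. No hyperedge of [A] meets one of [B], so a side shares
   vertices with the rest only through its own boundary. *)
apply: rooted_decomposition_glue dBX _.
  apply: rooted_decomposition_glue droot dA _.
  apply/subsetP => v; rewrite !inE => /andP[vR /bigcupP[f fAX vf]]; rewrite vR /=.
  move: vR => /bigcupP[e eR ve].
  have [fS|fS] := boolP (f \in S).
    by apply: cov vf; move: fAX; rewrite !inE fS => /andP[_ ->]; rewrite orbT.
  apply: (cov v _ e _ ve); move: fAX eR; rewrite !inE (negPf fS) orbF => /andP[fA fX].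
  have [eB|eB] := boolP (e \in B); first by have := cross v f e fA eB vf; rewrite ve.
  have := trisect e; have := inZ e; rewrite (negPf eB).
  by case: (e \in Z') => //= [/(_ isT) ->|_ _ ->]; rewrite ?orbT // => /(_ isT);
    case: (e \in A).
apply/subsetP => v; rewrite in_setI => /andP[/bigcupP[e eX1 ve] /bigcupP[f fBX vf]].
have [fS|fS] := boolP (f \in S).
  have fS' : f \in S' by move: fBX; rewrite !inE fS => /andP[_ ->].
  by rewrite inE; apply/andP; split; apply: cov vf; rewrite inE fS' orbT.
have fB : f \in B by move: fBX; rewrite !inE (negPf fS) orbF => /andP[].
have eA : e \notin A by apply: contraL vf => eA; exact: cross eA fB ve.
have eR : (e \in S') || (e \in B) && (e \in Z').
  move: eX1; rewrite !inE (negPf eA) /=.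
  have := trisect e; have := inZ e; rewrite (negPf eA) /=.
  case: (e \in Z') => [/(_ isT) -> /(_ isT)|_ _]; last by rewrite andbF orbF /= orbb.
  by rewrite !andbT.
rewrite inE; apply/andP; split; apply: cov ve; rewrite in_setU.
  by case/orP: eR => [->|/andP[_ ->]]; rewrite ?orbT.
by rewrite in_setI; case/orP: eR => [->|->]; rewrite ?orbT.
Qed.

End BalancedSeparators.

Local Open Scope ring_scope.

(** * Farkas' lemma *)

Section Farkas.
Variable R : realFieldType.

(** Yields a value for the variable that a Fourier-Motzkin step eliminates. *)
Lemma between_seqs (ls us : seq R) :
  (forall l u, l \in ls -> u \in us -> l <= u) ->
  exists t, (forall l, l \in ls -> l <= t) /\ (forall u, u \in us -> t <= u).
Proof.
elim: ls => [|l ls IH] H.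
  elim: us {H} => [|u us [t [_ IH]]]; first by exists 0.
  exists (Num.min u t); split=> // v; rewrite inE => /predU1P[->|/IH tv].
    by rewrite ge_min lexx.
  by rewrite ge_min tv orbT.
have [|t [Ht1 Ht2]] := IH; first by move=> l' u H1; apply: H; rewrite inE H1 orbT.
exists (Num.max l t); split=> [l'|u Hu].
  rewrite inE => /predU1P[->|/Ht1 H1]; first by rewrite le_max lexx.
  by rewrite le_max H1 orbT.
by rewrite ge_max Ht2 // andbT; apply: H; rewrite ?mem_head.
Qed.

Variables (K I : finType) (A : K -> I -> R) (b : K -> R).

(** Multipliers [z] stand for the derived inequality with coefficients [row z] and bound [rhs z];
    being finite functions, they have the decidable equality that membership in a sequence
    requires. *)
Let row (z : {ffun K -> R}) i := \sum_k z k * A k i.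
Let rhs (z : {ffun K -> R}) := \sum_k z k * b k.
Let comb (s t : R) (z w : {ffun K -> R}) := [ffun k => s * z k + t * w k].

Let row_comb s t z w i : row (comb s t z w) i = s * row z i + t * row w i.
Proof.
rewrite /row !mulr_sumr -big_split; apply: eq_bigr => k _ /=.
by rewrite ffunE; ring.
Qed.

Let rhs_comb s t z w : rhs (comb s t z w) = s * rhs z + t * rhs w.
Proof.
rewrite /rhs !mulr_sumr -big_split; apply: eq_bigr => k _ /=.
by rewrite ffunE; ring.
Qed.

(** Induction on the variables [s] not yet eliminated, each [z] staying a nonnegative combination of
    the original rows. With no variable left, a negative [rhs] is the certificate. *)
Let fourier_motzkin (s : seq I) (zs : seq {ffun K -> R}) : uniq s ->
  (forall z, z \in zs -> forall k, 0 <= z k) ->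
  (forall z, z \in zs -> forall i, i \notin s -> row z i = 0) ->
  (exists x : I -> R, forall z, z \in zs -> \sum_(i <- s) row z i * x i <= rhs z)
  \/ (exists z : {ffun K -> R},
        [/\ forall k, 0 <= z k, forall i, row z i = 0 & rhs z < 0]).
Proof.
elim: s zs => [|p s IH] zs /= => [_|/andP[ps us]] zs0 supp.
  have [/hasP[z zzs zn]|/hasPn pos] := boolP (has (fun z => rhs z < 0) zs).
    by right; exists z; split=> // [k|i]; [exact: zs0 | exact: supp].
  by left; exists (fun=> 0) => z /pos; rewrite big_nil -leNgt.
(* The combination cancels the coefficient of [p]. *)
pose pairs := [seq comb (row z p) (- row w p) w z |
  z <- [seq z <- zs | 0 < row z p], w <- [seq z <- zs | row z p < 0]].
pose zs' := [seq z <- zs | row z p == 0] ++ pairs.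
have in_zs' z : z \in zs' -> (z \in zs /\ row z p = 0) \/
    exists z1 z2, [/\ z1 \in zs, z2 \in zs, 0 < row z1 p, row z2 p < 0
                    & z = comb (row z1 p) (- row z2 p) z2 z1].
  rewrite mem_cat mem_filter => /orP[/andP[/eqP ? ?]|]; first by left.
  case/allpairsP=> -[z1 z2] /= []; rewrite !mem_filter.
  by move=> /andP[? ?] /andP[? ?] ->; right; exists z1, z2.
have [||[x xP]|] := IH zs' us; last by right.
- move=> z /in_zs'[[/zs0]//|[z1 [z2 [/zs0 h1 /zs0 h2 p1 p2 ->]]]] k.
  by rewrite ffunE addr_ge0 // mulr_ge0 // ?oppr_ge0 ltW.
- move=> z /in_zs'[[zz zp] i si|[z1 [z2 [h1 h2 p1 p2 ->]]] i si].
    have [->//|ip] := eqVneq i p.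
    by apply: supp zz _ _; rewrite inE negb_or ip.
  rewrite row_comb; have [->|ip] := eqVneq i p; first by ring.
  rewrite (supp z1 h1 i) ?(supp z2 h2 i) ?inE ?negb_or ?ip ?si //.
  by rewrite !mulr0 addr0.
pose rest z := \sum_(i <- s) row z i * x i.
(* The bound that [z] imposes on the variable [p]: upper if [row z p] is positive, lower if it is
   negative. *)
pose bd z := (rhs z - rest z) / row z p.
have [|t [tl tu]] := @between_seqs [seq bd z | z <- zs & row z p < 0]
    [seq bd z | z <- zs & 0 < row z p].
  move=> _ _ /mapP[z2 + ->] /mapP[z1 + ->]; rewrite !mem_filter.
  move=> /andP[p2 h2] /andP[p1 h1].
  have /xP : comb (row z1 p) (- row z2 p) z2 z1 \in zs'.
    rewrite mem_cat; apply/orP; right; apply/allpairsP; exists (z1, z2) => /=.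
    by rewrite !mem_filter p1 p2 h1 h2.
  have -> : \sum_(i <- s) row (comb (row z1 p) (- row z2 p) z2 z1) i * x i
            = row z1 p * rest z2 - row z2 p * rest z1.
    rewrite /rest !mulr_sumr -sumrB; apply: eq_bigr => i _.
    by rewrite row_comb; ring.
  rewrite rhs_comb /bd => H.
  by rewrite ler_pdivlMr // mulrAC ler_ndivrMr //; lra.
left; exists (fun i => if i == p then t else x i) => z zz.
rewrite big_cons eqxx.
rewrite (_ : \sum_(j <- s) _ = rest z); last first.
  rewrite /rest !big_seq; apply: eq_bigr => i si; case: eqP => // ip.
  by rewrite -ip si in ps.
have [zp|zp|zp] := ltrgtP (row z p) 0.
- have : bd z <= t by apply: tl; apply: map_f; rewrite mem_filter zp.
  by rewrite /bd ler_ndivrMr //; lra.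
- have : t <= bd z by apply: tu; apply: map_f; rewrite mem_filter zp.
  by rewrite /bd ler_pdivlMr //; lra.
- have : z \in zs' by rewrite mem_cat mem_filter zp eqxx zz.
  by move=> /xP; rewrite -/(rest z) zp mul0r add0r.
Qed.

Theorem farkas :
  (exists x : I -> R, forall k, \sum_i A k i * x i <= b k) \/
  (exists z : K -> R, [/\ forall k, 0 <= z k,
      forall i, \sum_k z k * A k i = 0 & \sum_k z k * b k < 0]).
Proof.
pose unitv k : {ffun K -> R} := [ffun j => (j == k)%:R].
have unitE k (f : K -> R) : \sum_j unitv k j * f j = f k.
  rewrite (bigD1 k) //= ffunE eqxx mul1r big1 ?addr0 // => j /negPf jk.
  by rewrite ffunE jk mul0r.
have [|z|z _ i||] := @fourier_motzkin (index_enum I) [seq unitv k | k <- enum K].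
- exact: index_enum_uniq.
- by move=> /mapP[k _ ->] j; rewrite ffunE.
- by rewrite mem_index_enum.
- move=> [x xP]; left; exists x => k.
  have /xP : unitv k \in [seq unitv k | k <- enum K].
    by apply: map_f; rewrite mem_enum.
  by rewrite /rhs unitE; under eq_bigr do rewrite /row unitE.
- by move=> [z [z0 zr zb]]; right; exists z.
Qed.

End Farkas.

(** Rows [- x j <= 0] are added; their multipliers equal the column sums, which become nonnegative
    instead of zero. *)
Theorem farkas_nonneg (R : realFieldType) (K I : finType)
    (A : K -> I -> R) (b : K -> R) :
  (exists x : I -> R,
     (forall i, 0 <= x i) /\ forall k, \sum_i A k i * x i <= b k) \/
  (exists z : K -> R, [/\ forall k, 0 <= z k,
      forall i, 0 <= \sum_k z k * A k i & \sum_k z k * b k < 0]).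
Proof.
pose A' (k : K + I) i := match k with inl k => A k i | inr j => - (j == i)%:R end.
pose b' (k : K + I) := if k is inl k then b k else 0.
have [[x xP]|[z [z0 zA zb]]] := farkas A' b'.
  left; exists x; split=> [i|k]; last exact: (xP (inl k)).
  have := xP (inr i); rewrite /= (bigD1 i) //= eqxx big1.
    by rewrite addr0 mulN1r oppr_le0.
  by move=> j /negPf ji; rewrite eq_sym ji oppr0 mul0r.
right; exists (fun k => z (inl k)); split=> [k|i|]; first exact: z0.
- have := zA i; rewrite big_sumType /= => /eqP; rewrite addr_eq0 => /eqP ->.
  rewrite oppr_ge0 big_seq sumr_le0 // => j _.
  by rewrite mulrN oppr_le0 mulr_ge0.
- by move: zb; rewrite big_sumType /= [X in _ + X]big1 ?addr0 // => j _; rewrite mulr0.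
Qed.

(** * Region growing *)

Section Stabbing.
Variable R : realFieldType.

(* The length of the part of [lo, hi] to the left of [t], if [lo <= hi]. *)
Definition len_upto (lo hi t : R) : R := Num.max 0 (Num.min t hi - lo).

Lemma len_upto_ge0 lo hi t : 0 <= len_upto lo hi t.
Proof. by rewrite le_max lexx. Qed.

Lemma len_upto_le lo hi t : lo <= hi -> len_upto lo hi t <= hi - lo.
Proof.
by move=> lh; rewrite ge_max subr_ge0 lh lerD2r ge_min lexx orbT.
Qed.

Lemma len_upto_eq0 lo hi t : t <= lo -> len_upto lo hi t = 0.
Proof. by move=> tl; apply/max_idPl; rewrite subr_le0 ge_min tl. Qed.

(* [p, q] is the interval [l, h] clamped to [a, b]. *)
Lemma len_upto_clamp (l h a b : R) : l <= h -> a < b ->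
  exists p q, [/\ [/\ a <= p, p <= q & q <= b],
    len_upto l h b - len_upto l h a = q - p,
    a < p -> p <= l & q < b -> h <= q].
Proof.
move=> lh ab; have hl : 0 <= h - l by rewrite subr_ge0.
have [ha|ah] := leP h a.
  exists a, a; split; [by split; lra | | lra | by []].
  rewrite /len_upto (min_idPr ha) (min_idPr _); last by rewrite ltW // (le_lt_trans ha).
  by rewrite !subrr.
have [bl|lb] := leP b l.
  exists b, b; split; [by split; lra | | by [] | lra].
  by rewrite !len_upto_eq0 ?subrr // ltW // (lt_le_trans ab).
have len_b : len_upto l h b = Num.min b h - l.
  by apply/max_idPr; rewrite subr_ge0 le_min lh ltW.
have len_a : len_upto l h a = Num.max a l - l.
  rewrite /len_upto (min_idPl (ltW ah)).
  by case: (leP a l) => al; [rewrite (max_idPl _) | rewrite (max_idPr _)]; lra.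
exists (Num.max a l), (Num.min b h).
rewrite len_b len_a; split.
- by rewrite le_max lexx ge_min lexx le_min !ge_max (ltW ab) (ltW lb) (ltW ah) lh.
- by ring.
- by rewrite ge_max lexx andbT; case: (leP a l) => // _; rewrite ltxx.
- by rewrite le_min lexx andbT; case: (leP b h) => [_|/ltW //]; rewrite ltxx.
Qed.

(** Averaging without integrals. Cut the range from [a] to [b] at the ends of the first interval;
    the other intervals have budget [k - 1] inside it and [k] outside. If all three pieces reached
    their budgets, so would the total. *)
Lemma exists_lightly_stabbed (T : Type) (lo hi : T -> R) (s : seq T) (k a b : R) :
  (forall i, lo i <= hi i) -> a < b ->
  \sum_(i <- s) (len_upto (lo i) (hi i) b - len_upto (lo i) (hi i) a)
    < k * (b - a) ->
  exists r, [/\ a < r, r < b & (\sum_(i <- s) (lo i <= r <= hi i)%R)%N%:R < k].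
Proof.
move=> lohi; elim: s k a b => [|i s IH] k a b ab.
  rewrite big_nil => H; exists ((a + b) / 2); rewrite big_nil; split; [lra|lra|].
  by move: H; rewrite pmulr_lgt0 // subr_gt0.
pose G t := \sum_(i <- s) len_upto (lo i) (hi i) t.
rewrite big_cons sumrB -/(G b) -/(G a) => H.
have IH' k' a' b' : a' < b' -> G b' - G a' < k' * (b' - a') ->
    exists r, [/\ a' < r, r < b' & (\sum_(i <- s) (lo i <= r <= hi i)%R)%N%:R < k'].
  by move=> ab'; rewrite -sumrB; exact: IH.
have := lohi i; move Dl: (lo i) H => l H; move Dh: (hi i) H => h H lh.
have [p [q [[ap pq qb] lenE pl hq]]] := len_upto_clamp lh ab.
rewrite lenE in H.
have [c1|c1] := ltP (G p - G a) (k * (p - a)).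
  have ap' : a < p.
    by rewrite lt_neqAle ap andbT; apply: contraTneq c1 => <-; rewrite !subrr mulr0 ltxx.
  have [r [ar rp rk]] := IH' _ _ _ ap' c1.
  exists r; split=> //; first by lra.
  rewrite big_cons Dl Dh; case: (boolP (l <= r <= h)) => [/andP[lr _]|_]; last by rewrite /= add0n.
  by have := pl ap'; lra.
have [c2|c2] := ltP (G q - G p) ((k - 1) * (q - p)).
  have pq' : p < q.
    by rewrite lt_neqAle pq andbT; apply: contraTneq c2 => <-; rewrite !subrr mulr0 ltxx.
  have [r [pr rq rk]] := IH' _ _ _ pq' c2.
  exists r; split=> //; [lra|lra|].
  rewrite big_cons Dl Dh natrD.
  have : ((l <= r <= h)%R%:R <= 1 :> R) by case: (_ && _); rewrite ?lexx ?ler01.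
  lra.
have [c3|c3] := ltP (G b - G q) (k * (b - q)).
  have qb' : q < b.
    by rewrite lt_neqAle qb andbT; apply: contraTneq c3 => ->; rewrite !subrr mulr0 ltxx.
  have [r [qr rb rk]] := IH' _ _ _ qb' c3.
  exists r; split=> //; first by lra.
  rewrite big_cons Dl Dh; case: (boolP (l <= r <= h)) => [/andP[_ rh]|_]; last by rewrite /= add0n.
  by have := hq qb'; lra.
exfalso; lra.
Qed.

End Stabbing.

(** * Separators by ball carving *)

Section BallCarving.
Variables (R : realFieldType) (N : finType) (g : rel N) (E W : {set N}).
Variables (y : N -> R) (d : N -> N -> R) (D delta : R) (J : nat).
Hypotheses (y0 : forall e, 0 <= y e).
Hypotheses (dxx : forall w, d w w = 0).
Hypothesis (lip : forall w, {in E &, forall e f, g e f ->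
   d w f - d w e <= y e + y f}).
Hypotheses (delta0 : 0 < delta) (sumy : \sum_(e in E) y e < D).
Hypotheses (J0 : (0 < J)%N) (LJ : (3 * #|W| <= 2 ^ J)%N).
Hypothesis (spread : forall w, w \in W ->
  (4 * #|[set e in W | (d w e < delta)%R]| <= 3 * #|W|)%N).

Let D0 : 0 < D.
Proof. by apply: le_lt_trans sumy; apply: sumr_ge0. Qed.

(* Region growing: among [J] concentric annuli of width [delta / J] one does
   not double the volume enclosed by its inner sphere; an average sphere
   inside it has few vertices. *)
Lemma carve_ball (U : {set N}) w : U \subset E -> w \in U -> w \in W ->
  exists A S : {set N},
  [/\ [disjoint A & S], A :|: S \subset U, w \in A :|: S,
      [/\ A \subset [set e | d w e < delta] &
        {in A & U :\: (A :|: S), forall e f, ~~ g e f}] &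
      #|S|%:R <= J%:R / delta * (D / #|W|%:R + 2 * \sum_(e in A :|: S) y e)].
Proof.
move=> UE wU wW.
have L0 : 0 < #|W|%:R :> R by rewrite ltr0n; apply/card_gt0P; exists w.
have JR0 : 0 < J%:R :> R by rewrite ltr0n.
(* By [lip], intervals of adjacent vertices overlap, so no edge joins one wholly below [r] to one
   wholly above. *)
pose lo e := d w e - y e; pose hi e := d w e + y e.
have lohi e : lo e <= hi e by rewrite /lo /hi; have := y0 e; lra.
pose vol t := D / #|W|%:R + \sum_(e in U) len_upto (lo e) (hi e) t.
pose rad (j : nat) := j%:R * (delta / J%:R).
have [j jJ volj] : exists2 j, (j < J)%N & vol (rad j.+1) < 2 * vol (rad j).
  have [/existsP[j]|] := boolP [exists j : 'I_J, vol (rad j.+1) < 2 * vol (rad j)].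
    by exists j.
  (* The seed [D / #|W|%:R] doubled [J] times reaches at least [3 * D], while the whole volume is
     less than [3 * D]. *)
  rewrite negb_exists => /forallP dbl; exfalso.
  have dbls : forall j, (j <= J)%N -> 2 ^+ j * (D / #|W|%:R) <= vol (rad j).
    elim=> [_|j IH jJ].
      by rewrite expr0 mul1r lerDl sumr_ge0 // => e _; exact: len_upto_ge0.
    have := dbl (Ordinal jJ); rewrite -leNgt /=; apply: le_trans.
    by rewrite exprS -mulrA ler_pM2l ?ltr0n // IH // ltnW.
  have {}dbls := dbls J (leqnn J).
  have volJ : vol (rad J) <= D / #|W|%:R + 2 * \sum_(e in U) y e.
    rewrite lerD2l mulr_sumr ler_sum // => e _.
    by apply: le_trans (len_upto_le _ (lohi e)) _; rewrite /lo /hi; lra.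
  have sumU : \sum_(e in U) y e <= \sum_(e in E) y e.
    rewrite [leRHS](bigID (mem U)) /= ler_wpDr ?sumr_ge0 //.
    rewrite le_eqVlt; apply/orP; left; apply/eqP/eq_bigl => e.
    by rewrite andb_idl // => /(subsetP UE).
  have L1 : 1 <= #|W|%:R :> R by rewrite ler1n -(ltr0n R).
  have DL : D / #|W|%:R <= D by rewrite ler_pdivrMr // ler_peMr // ltW.
  have : 3 * D <= 2 ^+ J * (D / #|W|%:R).
    rewrite mulrA ler_pdivlMr // mulrAC ler_pM2r //.
    by rewrite -natrX -natrM ler_nat.
  move=> /le_trans /(_ dbls) /le_trans /(_ volJ).
  by have := sumy; lra.
have dJ0 : 0 < delta / J%:R by rewrite divr_gt0.
have rad1 : rad j.+1 - rad j = delta / J%:R by rewrite /rad -natr1; ring.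
have rad0 : 0 <= rad j by rewrite mulr_ge0 // ltW.
have radlt : rad j < rad j.+1 by lra.
have radJ : rad j.+1 <= delta.
  by rewrite /rad mulrCA ler_piMr ?(ltW delta0) // ler_pdivrMr // mul1r ler_nat.
(* The annulus has width [delta / J%:R], so the bound chosen here times the width is the inner
   volume. *)
have [|r [rl ru rk]] := @exists_lightly_stabbed R _ lo hi (enum U)
   (vol (rad j) * (J%:R / delta)) _ _ lohi radlt.
  rewrite rad1 -mulrA (_ : J%:R / delta * _ = 1); last by field; rewrite !gt_eqF.
  rewrite mulr1 sumrB !big_enum /=.
  by move: volj; rewrite /vol; lra.
pose A := [set e in U | hi e < r]; pose S := [set e in U | lo e <= r <= hi e].
exists A, S; split.
- rewrite disjoint_subset; apply/subsetP => e; rewrite !inE => /andP[_ h].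
  by rewrite (leNgt r) h !andbF.
- by apply/subsetP => e; rewrite !inE -andb_orr => /andP[].
- rewrite !inE wU /=; case: ltP => //= _; rewrite andbT /lo dxx.
  by have := y0 w; lra.
- split.
    apply/subsetP => e; rewrite !inE => /andP[_]; rewrite /hi.
    by have := y0 e; lra.
  move=> e f; rewrite !inE => /andP[eU eA] /andP[+ fU]; rewrite fU /=.
  move=> fAS; apply/negP => gef.
  have := lip w (subsetP UE _ eU) (subsetP UE _ fU) gef.
  move: fAS; case: (ltP (hi f) r) => //= rf; rewrite andbT -ltNge => lof.
  move: eA lof; rewrite /hi /lo; lra.
have -> : #|S| = (\sum_(i <- enum U) (lo i <= r <= hi i)%R)%N.
  by rewrite big_enum -big_mkcondr sum1dep_card.
apply: le_trans (ltW rk) _; rewrite mulrC.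
rewrite ler_pM2l ?divr_gt0 //.
(* Intervals outside [A :|: S] start beyond [r], so they contribute nothing to the volume at
   [rad j]. *)
rewrite lerD2l mulr_sumr [leLHS](bigID (mem (A :|: S))) /=.
rewrite [X in _ + X]big1 ?addr0.
  rewrite (eq_bigl (mem (A :|: S))).
    by apply: ler_sum => e _; apply: le_trans (len_upto_le _ (lohi e)) _; rewrite /lo /hi; lra.
  by move=> e; rewrite /= !inE; case: (e \in U).
move=> e /andP[eU]; rewrite !inE eU /= => eAS; apply: len_upto_eq0.
rewrite leNgt; apply: contra eAS => lor.
by case: ltP => //= _; rewrite andbT; lra.
Qed.

(** Balls are carved while the rest [U] holds more than 7/8 of [W]. Each ball pays with its centre,
    worth [D / #|W|%:R], and with twice the [y] of its carved part; the total is less than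
    [3 * D]. *)
Lemma ball_carving : exists A S B : {set N},
  [/\ A :|: S :|: B = E, [disjoint A & S] && [disjoint A :|: S & B],
      {in A & B, forall e f, ~~ g e f}, #|S|%:R < 3 * J%:R * D / delta &
      (8 * #|A :&: W| <= 7 * #|W|)%N && (8 * #|B :&: W| <= 7 * #|W|)%N].
Proof.
have JR0 : 0 < J%:R :> R by rewrite ltr0n.
pose cost (U : {set N}) : R :=
  J%:R / delta * (D / #|W|%:R * #|W :\: U|%:R + 2 * \sum_(e in E :\: U) y e).
suff carve n (U A S : {set N}) : (#|U| < n)%N ->
    A :|: S :|: U = E -> [disjoint A & S] -> [disjoint A :|: S & U] ->
    {in A & U, forall e f, ~~ g e f} -> #|S|%:R <= cost U ->
    (8 * #|A :&: W| <= 7 * #|W|)%N -> exists A S B : {set N},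
    [/\ A :|: S :|: B = E, [disjoint A & S] && [disjoint A :|: S & B],
      {in A & B, forall e f, ~~ g e f}, #|S|%:R <= cost B &
      (8 * #|A :&: W| <= 7 * #|W|)%N && (8 * #|B :&: W| <= 7 * #|W|)%N].
  have [|||||||A [S [B [h1 h2 h3 h4 h5]]]] := carve #|E|.+1 E set0 set0.
  - by [].
  - by rewrite !set0U.
  - by rewrite -setI_eq0 setI0.
  - by rewrite -setI_eq0 setU0 set0I.
  - by move=> e f; rewrite inE.
  - rewrite /cost cards0 mulr_ge0 ?(ltW (divr_gt0 JR0 delta0)) //.
    by rewrite addr_ge0 ?mulr_ge0 ?sumr_ge0 ?invr_ge0 ?(ltW D0).
  - by rewrite set0I cards0.
  exists A, S, B; split=> //; apply: le_lt_trans h4 _.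
  rewrite /cost [ltRHS](_ : _ = J%:R / delta * (3 * D)); last by ring.
  rewrite ltr_pM2l ?divr_gt0 //.
  have b1 : \sum_(e in E :\: B) y e <= \sum_(e in E) y e.
    rewrite [leRHS](bigID (mem B)) /= ler_wpDl ?sumr_ge0 //.
    rewrite le_eqVlt; apply/orP; left; apply/eqP/eq_bigl => e.
    by rewrite !inE andbC.
  have b2 : D / #|W|%:R * #|W :\: B|%:R <= D.
    have [->|W0] := eqVneq #|W| 0%N; first by rewrite invr0 mulr0 mul0r ltW.
    rewrite mulrAC ler_pdivrMr ?ltr0n ?lt0n // ler_pM2l // ler_nat.
    by rewrite subset_leq_card // subsetDl.
  by have := sumy; lra.
elim: n U A S => // n IH U A S Un EE dAS dASU gAU cS A7.
have UE : U \subset E by rewrite -EE subsetUr.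
have [stop|go] := leqP (8 * #|U :&: W|) (7 * #|W|).
  by exists A, S, U; split=> //; apply/andP.
have [|[w]] := set_0Vmem (U :&: W); first by move=> UW0; rewrite UW0 cards0 in go.
rewrite inE => /andP[wU wW].
have [A1 [S1 [dAS1 AS1U wAS1 [A1d gA1] cS1]]] := carve_ball UE wU wW.
have /subUsetP[A1U S1U] := AS1U.
apply: (IH (U :\: (A1 :|: S1)) (A :|: A1) (S :|: S1)).
- rewrite -ltnS; apply: leq_trans _ Un; rewrite ltnS; apply: proper_card.
  rewrite properE subsetDl /=; apply/subsetPn; exists w => //.
  by rewrite inE wAS1.
- rewrite -[RHS]EE; apply/setP => e; rewrite !inE.
  have /implyP := subsetP A1U e; have /implyP := subsetP S1U e.
  by case: (e \in A1); case: (e \in S1); case: (e \in U); case: (e \in A);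
     case: (e \in S) => //.
- move: dAS dASU; rewrite -!setI_eq0 => /eqP/setP dAS /eqP/setP dASU.
  move: dAS1; rewrite -setI_eq0 => /eqP/setP dAS1.
  apply/eqP/setP => e; have /implyP := subsetP A1U e; have /implyP := subsetP S1U e.
  move: (dAS e) (dASU e) (dAS1 e); rewrite !inE.
  by case: (e \in A1); case: (e \in S1); case: (e \in U); case: (e \in A);
     case: (e \in S) => //.
- move: dASU; rewrite -!setI_eq0 => /eqP/setP dASU.
  apply/eqP/setP => e; move: (dASU e); rewrite !inE.
  by case: (e \in A1); case: (e \in S1); case: (e \in U); case: (e \in A);
     case: (e \in S).
- move=> e f; rewrite inE => /orP[eA|eA1] fU; last exact: gA1.
  by apply: gAU => //; move: fU; rewrite inE => /andP[].
- have : (#|S :|: S1| <= #|S| + #|S1|)%N by rewrite cardsU leq_subr.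
  rewrite -(ler_nat R) natrD => h.
  apply: le_trans h _; apply: le_trans (lerD cS cS1) _.
  rewrite /cost -mulrDr ler_pM2l ?divr_gt0 //.
  have -> : \sum_(e in E :\: (U :\: (A1 :|: S1))) y e =
      \sum_(e in E :\: U) y e + \sum_(e in A1 :|: S1) y e.
    rewrite -bigU /=; last first.
      rewrite disjoint_sym disjoint_subset; apply/subsetP => e /(subsetP AS1U).
      by rewrite !inE => ->.
    apply: eq_bigl => e; rewrite !inE.
    have /implyP := subsetP AS1U e; have /implyP := subsetP UE e; rewrite !inE.
    by case: (e \in A1); case: (e \in S1); case: (e \in U); case: (e \in E) => //.
  have : (#|W :\: U|.+1 <= #|W :\: (U :\: (A1 :|: S1))|)%N.
    apply: proper_card; rewrite properE setDS ?subsetDl //=.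
    apply/subsetPn; exists w; rewrite !inE wW ?wU // -in_setU wAS1 //.
  rewrite -(ler_nat R) -natr1 => hW.
  have : D / #|W|%:R * (#|W :\: U|%:R + 1) <=
         D / #|W|%:R * #|W :\: (U :\: (A1 :|: S1))|%:R.
    by rewrite ler_wpM2l // divr_ge0 ?(ltW D0).
  lra.
(* At most 1/8 of [W] was in [A], as [U] held more than 7/8, and the new ball adds at most 3/4. *)
- have h1 : (#|(A :|: A1) :&: W| <= #|A :&: W| + #|A1 :&: W|)%N.
    by rewrite setIUl cardsU leq_subr.
  have h2 : (#|A :&: W| + #|U :&: W| <= #|W|)%N.
    rewrite -cardsUI (_ : (A :&: W) :&: (U :&: W) = set0) ?cards0 ?addn0.
      by rewrite -setIUl subset_leq_card // subsetIr.
    move: dASU; rewrite -!setI_eq0 => /eqP/setP dASU.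
    apply/setP => e; move: (dASU e); rewrite !inE.
    by case: (e \in U); case: (e \in A); case: (e \in S) => //; rewrite ?andbF.
  have h3 : (4 * #|A1 :&: W| <= 3 * #|W|)%N.
    apply: leq_trans (spread wW); rewrite leq_mul2l; apply/orP; right.
    apply: subset_leq_card; apply/subsetP => e; rewrite !inE => /andP[+ ->].
    by move=> /(subsetP A1d); rewrite inE.
  by move: h1 h2 h3 go; clear; lia.
Qed.

End BallCarving.

(** * Routings and separators *)

Lemma separates_pair (T : finType) (F : {set T}) (e f : T) :
  separates F [set e; f] = ((e \in F) != (f \in F)).
Proof.
apply/exists_inP/idP => [[x xF /exists_inP[y]]|].
  rewrite inE => yF /eqP efxy.
  have /set2P ex : e \in [set x; y] by rewrite -efxy set21.
  have /set2P fx : f \in [set x; y] by rewrite -efxy set22.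
  have /set2P xe : x \in [set e; f] by rewrite efxy set21.
  have /set2P ye : y \in [set e; f] by rewrite efxy set22.
  have xy : x != y by apply: contraNneq yF => <-.
  case: ex fx xe ye => -> [->|->] xe ye; rewrite ?xF ?(negPf yF) //.
    by case: ye => yx; rewrite yx eqxx in xy.
  by case: xe => xy'; rewrite xy' eqxx in xy.
have [eF fF|eF /negPn fF] := boolP (e \in F).
  by exists e => //; apply/exists_inP; exists f; rewrite ?inE //; case: (f \in F) fF.
by exists f; rewrite ?fF //; apply/exists_inP; exists e; rewrite ?inE // setUC.
Qed.

Section Dichotomy.
Variables (R : realType) (V : finType) (E W : {set {set V}}) (J : nat).
Hypotheses (J0 : (0 < J)%N) (LJ : (3 * #|W| <= 2 ^ J)%N).

(** The constant 288 is 8 times 36: with radius 1/12, carving yields a separator smaller than 36 J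
    D, which is an eighth of [#|W|]. *)
Let D : R := #|W|%:R / (288 * J%:R).
Let ok (F : {set {set V}}) := (F \subset E) && balanced W F.

(* Every balanced [F] splits any subset [U] of [W] with more than three quarters
   of [W], so [U] has positive average distance from each of its points in the
   cut metric [d] and lies in no ball of radius 1/12. *)
Lemma separator_of_cut_distribution (mu : {set {set V}} -> R) (y : {set V} -> R) :
  (forall F, 0 <= mu F) -> (forall F, ~~ ok F -> mu F = 0) ->
  (forall e, 0 <= y e) ->
  (forall e f, e \in E -> f \in E -> e != f -> e :&: f != set0 ->
     \sum_(F : {set {set V}} | (e \in F) != (f \in F)) mu F <= y e + y f) ->
  \sum_(e in E) y e < D * \sum_F mu F ->
  exists A S B : {set {set V}},
  [/\ A :|: S :|: B = E, [disjoint A & S] && [disjoint A :|: S & B],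
      {in A & B, forall e f, e :&: f = set0}, (8 * #|S| < #|W|)%N &
      (8 * #|A :&: W| <= 7 * #|W|)%N && (8 * #|B :&: W| <= 7 * #|W|)%N].
Proof.
move=> mu0 mu_ok y0 edge sumy.
have JR0 : 0 < J%:R :> R by rewrite ltr0n.
set M := \sum_F mu F in sumy.
have D0 : 0 <= D by rewrite divr_ge0 ?mulr_ge0.
have M0 : 0 < M.
  rewrite lt_neqAle sumr_ge0 // andbT eq_sym; apply/eqP => M0.
  by move: sumy; rewrite M0 mulr0 ltNge sumr_ge0.
(* [mu / M] is a probability on balanced cuts, and [d] the probability of being separated. *)
pose d (w e : {set V}) : R := (\sum_(F : {set {set V}} | (w \in F) != (e \in F)) mu F) / M.
have dxx w : d w w = 0.
  by rewrite /d big_pred0 ?mul0r // => F; rewrite eqxx.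
have lip w : {in E &, forall e f, e :&: f != set0 -> d w f - d w e <= y e / M + y f / M}.
  move=> e f eE fE ef; rewrite /d -mulrBl -mulrDl ler_pM2r ?invr_gt0 //.
  have [->|nef] := eqVneq e f; first by rewrite subrr addr_ge0.
  apply: le_trans (edge e f eE fE nef ef).
  rewrite lerBlDr [X in X <= _]big_mkcond [X in _ <= X + _]big_mkcond.
  rewrite [X in _ <= _ + X]big_mkcond -big_split /= ler_sum // => F _.
  have := mu0 F.
  by case: (w \in F); case: (e \in F); case: (f \in F) => /=; lra.
have spread w : w \in W ->
    (4 * #|[set e in W | (d w e < 1 / 12)%R]| <= 3 * #|W|)%N.
  move=> wW; set U := [set e in W | _]; rewrite leqNgt; apply/negP => Ubig.
  have UW : U \subset W by apply/subsetP => e; rewrite inE => /andP[].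
  have up : \sum_(e in U) d w e <= #|U|%:R * (1 / 12).
    by rewrite -sumr_const mulr_suml ler_sum // => e; rewrite inE !mul1r => /andP[_ /ltW].
  have swap : (\sum_(e in U) d w e) * M =
      \sum_(F : {set {set V}}) mu F * #|[set e in U | (w \in F) != (e \in F)]|%:R.
    rewrite mulr_suml.
    under eq_bigr do rewrite /d mulfVK ?gt_eqF // big_mkcond.
    rewrite exchange_big; apply: eq_bigr => F _ /=.
    rewrite -big_mkcondr sumr_const mulr_natr; congr (_ *+ _).
    by apply: eq_card => x; rewrite [in RHS]inE.
  (* A balanced cut leaves at least |U| - 2|W|/3 elements of [U] on the side opposite to [w]. *)
  have low : (12 * #|U|%:R - 8 * #|W|%:R) * M <= 12 * ((\sum_(e in U) d w e) * M).
    rewrite swap /M !mulr_sumr ler_sum // => F _.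
    have [okF|/mu_ok ->] := boolP (ok F); last by rewrite mulr0 mul0r mulr0.
    rewrite mulrC mulrCA ler_wpM2l // lerBlDr -!natrM -natrD ler_nat.
    case/andP: okF => _ /andP[big1 big2].
    have := cardsID F W; rewrite setIC => FW.
    have [wF|wF] := boolP (w \in F).
      have -> : [set e in U | true != (e \in F)] = U :\: F.
        by apply/setP => e; rewrite !inE andbC; case: (e \in F).
      have := cardsID F U.
      have : (#|U :&: F| <= #|F :&: W|)%N by rewrite setIC subset_leq_card // setIS.
      by move: big1 big2 FW; clear; lia.
    have -> : [set e in U | false != (e \in F)] = U :&: F.
      by apply/setP => e; rewrite !inE; case: (e \in F).
    have := cardsID F U.
    have : (#|U :\: F| <= #|W :\: F|)%N by rewrite subset_leq_card // setSD.
    by move: big1 big2 FW; clear; lia.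
  (* This gives 11|U| <= 8|W|, whereas |U| > 3|W|/4; the radius 1/12 is small enough for the
     contradiction. *)
  have : (12 * #|U|%:R - 8 * #|W|%:R) <= 12 * (#|U|%:R * (1 / 12)) :> R.
    rewrite -(ler_pM2r M0); apply: le_trans low _; rewrite -mulrA ler_pM2l ?ltr0n //.
    by rewrite ler_pM2r.
  have : 3 * #|W|%:R < 4 * #|U|%:R :> R by rewrite -!natrM ltr_nat.
  by have : 0 <= #|W|%:R :> R by []; lra.
have sumy' : \sum_(e in E) y e / M < D by rewrite -mulr_suml ltr_pdivrMr.
have y0' e : 0 <= y e / M by rewrite divr_ge0 // ltW.
have [] := @ball_carving R _ (fun e f : {set V} => e :&: f != set0) E W
  (fun e => y e / M) d D (1 / 12) J y0' dxx lip _ sumy' J0 LJ spread.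
  by lra.
move=> A [S [B [h1 h2 h3 h4 h5]]]; exists A, S, B; split=> //.
  by move=> e f eA fB; apply/eqP/negPn; exact: h3.
rewrite -(ltr_nat R) natrM; move: h4; rewrite /D.
have -> : 3 * J%:R * (#|W|%:R / (288 * J%:R)) / (1 / 12) = #|W|%:R / 8 :> R.
  by field; rewrite gt_eqF.
by rewrite ltr_pdivlMr ?ltr0n // mulrC.
Qed.

(** Farkas' lemma for the system in [alpha]: loads at most 1, balanced cuts at least [D]. A
    certificate of infeasibility has multipliers [y] for hyperedges and [mu] for cuts; its column
    for a pair bounds the mass of the cuts separating that pair. *)
Lemma routing_or_separator :
  (exists alpha : {set {set V}} -> R,
    [/\ forall p, 0 <= alpha p,
        forall e, e \in E -> incident_weight E alpha e <= 1 &
        forall F : {set {set V}}, F \subset E -> balanced W F -> D <= cut_demand E alpha F]) \/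
  (exists A S B : {set {set V}},
  [/\ A :|: S :|: B = E, [disjoint A & S] && [disjoint A :|: S & B],
      {in A & B, forall e f, e :&: f = set0}, (8 * #|S| < #|W|)%N &
      (8 * #|A :&: W| <= 7 * #|W|)%N && (8 * #|B :&: W| <= 7 * #|W|)%N]).
Proof.
(* The indices range over whole types; the indicators turn the rows of sets outside [E] and of cuts
   that are not [ok] into [0 <= 0]. *)
pose coef (k : {set V} + {set {set V}}) (p : {set {set V}}) : R :=
  match k with
  | inl e => ((p \in line_edges E) && (e \in p))%:R
  | inr F => - [&& ok F, p \in line_edges E & separates F p]%:R
  end.
pose bound (k : {set V} + {set {set V}}) : R :=
  match k with
  | inl e => (e \in E)%:R
  | inr F => - (D * (ok F)%:R)
  end.
have [[x [x0 xP]]|[z [z0 zA zb]]] := farkas_nonneg coef bound; [left|right].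
  exists x; split=> // [e eE|F FE Fbal].
    have := xP (inl e); rewrite /= eE; apply: le_trans.
    rewrite /incident_weight big_mkcond ler_sum // => p _.
    by case: (_ && _); rewrite ?mul1r ?mul0r.
  have := xP (inr F); rewrite /= {2}/ok FE Fbal mulr1.
  rewrite lerNr -sumrN; move=> /le_trans; apply.
  rewrite /cut_demand [leRHS]big_mkcond ler_sum // => p _.
  by rewrite /ok FE Fbal /=; case: (_ && _); rewrite ?mulN1r ?opprK ?oppr0 ?mul0r ?oppr0.
pose mu (F : {set {set V}}) := z (inr F) * (ok F)%:R.
apply: (@separator_of_cut_distribution mu (fun e => z (inl e))) => //.
- by move=> F; rewrite mulr_ge0.
- by move=> F /negPf okF; rewrite /mu okF mulr0.
- move=> e f eE fE ef nef; have := zA [set e; f].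
  have efE : [set e; f] \in line_edges E.
    rewrite inE; apply/exists_inP; exists e => //; apply/exists_inP; exists f => //.
    by rewrite eqxx ef.
  rewrite big_sumType /= efE.
  have -> : \sum_e0 z (inl e0) * (true && (e0 \in [set e; f]))%:R = z (inl e) + z (inl f).
    rewrite (bigD1 e) //= (bigD1 f) 1?eq_sym //= !inE !eqxx orbT !mulr1 big1 ?addr0 //.
    by move=> e' /andP[/negPf e'e /negPf e'f]; rewrite !inE e'e e'f mulr0.
  move=> H; rewrite -subr_ge0; apply: le_trans H _; rewrite lerD2l -sumrN.
  rewrite [leRHS]big_mkcond ler_sum // => F _; rewrite separates_pair /mu.
  case: (_ != _); case: (ok F); rewrite /= ?mulr1 ?mulrN1 ?mulr0 ?oppr0 ?mulr0 ?oppr0 //.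
- move: zb; rewrite big_sumType /= => zb.
  rewrite -subr_lt0; apply: le_lt_trans zb; rewrite le_eqVlt; apply/orP; left; apply/eqP.
  congr (_ + _).
    rewrite big_mkcond; apply: eq_bigr => e _.
    by case: (_ \in _); rewrite ?mulr1 ?mulr0.
  rewrite mulr_sumr -sumrN; apply: eq_bigr => F _; rewrite /mu; ring.
Qed.

End Dichotomy.

(** * Widths and the routing ratio *)

(* Imported only here because it shadows the finite-set vocabulary. *)
From mathcomp Require Import all_classical all_reals all_analysis.

Section Widths.
Variables (R : realType) (V : finType) (E : {set {set V}}).
Hypothesis niso : no_isolated E.

Lemma width_ge0 (b : {set V} -> R) (T : finType) (B : T -> {set V}) :
  0 <= width b B.
Proof. exact: bigmax_ge_id. Qed.

Lemma tau_le_width (b : {set V} -> R) (T : finType) (a : rel T) (B : T -> {set V}) :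
  tree_decomposition E a B -> tau E b <= width b B.
Proof.
move=> dec; apply: ge_inf; last by exists T, a, B.
by exists 0 => _ [T' [a' [B' [_ ->]]]]; exact: width_ge0.
Qed.

(** The one-bag decomposition makes the set of widths nonempty, so its infimum is a genuine greatest
    lower bound. *)
Lemma le_tau (b : {set V} -> R) x :
  (forall (T : finType) (a : rel T) (B : T -> {set V}),
     tree_decomposition E a B -> x <= width b B) -> x <= tau E b.
Proof.
move=> xP; apply: lb_le_inf => [|_ [T [a [B [dec ->]]]]]; last exact: xP dec.
have [T [a [bag [dec _]]]] :=
  rooted_decomposition_tree niso (rooted_decomposition_single (leqnn #|E|)).
by exists (width b (fun u => finset.cover (bag u))), T, a, (fun u => finset.cover (bag u)).
Qed.

Lemma edge_cover_number_le (F : {set {set V}}) :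
  F \subset E -> (edge_cover_number E (finset.cover F) <= #|F|)%N.
Proof.
move=> FE; rewrite /edge_cover_number; case: arg_minnP.
  by rewrite fintype.subxx /= coverS.
by move=> G _; apply; rewrite FE fintype.subxx.
Qed.

Lemma ghw_le (Z : {set {set V}}) m : rooted_decomposition E Z m -> ghw R E <= m%:R.
Proof.
move=> /(rooted_decomposition_tree niso)[T [a [bag [dec bagP]]]].
apply: le_trans (tau_le_width _ dec) _; apply: bigmax_le => // u _.
have [uE um] := bagP u; rewrite ler_nat.
exact: leq_trans (edge_cover_number_le uE) um.
Qed.

Lemma tau_le_subw (b : {set V} -> R) : one_Sub E b -> ((tau E b)%:E <= subw R E)%E.
Proof. by move=> bS; apply: ereal_sup_ubound; exists b. Qed.

Lemma subw_ge0 : (0 <= subw R E)%E.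
Proof.
apply: le_trans (tau_le_subw (b := fun=> 0) _).
  by rewrite lee_fin; apply: le_tau => T a B _; exact: width_ge0.
by split=> // *; rewrite addr0.
Qed.

(** Some bag contains the boundary of a balanced [F], so its [b]-value is at least [D / r]. The
    product form suits [subw] being an extended real. *)
Lemma balanced_demand_le_subw (W : {set {set V}}) (q : {set {set V}} -> R) D r k :
  W \subset E -> (1 < #|W|)%N -> 0 < D ->
  (forall F : {set {set V}}, F \subset E -> balanced W F -> D <= q F) ->
  0 <= r -> K_Sub E k -> (forall F : {set {set V}}, F \subset E -> q F = r * k F) ->
  (D%:E <= r%:E * subw R E)%E.
Proof.
move=> WE W1 D0 Dq r0 [k0 [b bS kb]] qk.
have main (T : finType) (a : rel T) (B : T -> {set V}) :
    tree_decomposition E a B -> D <= r * width b B.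
  move=> dec; have [u [F [FE Fbal Fu]]] := bag_contains_balanced_boundary dec WE W1.
  apply: le_trans (Dq F FE Fbal) _; rewrite qk // ler_wpM2l //.
  apply: le_trans (kb F FE) _; rewrite /lambda.
  case: (bS) => _ _ mono _ _; apply: le_trans (mono _ _ Fu) _.
  exact: (le_bigmax _ (fun u => b (B u))).
have rgt0 : 0 < r.
  rewrite lt_neqAle r0 andbT eq_sym; apply/eqP => rE.
  have [T [a [bag [dec _]]]] :=
    rooted_decomposition_tree niso (rooted_decomposition_single (leqnn #|E|)).
  by have := main _ _ _ dec; rewrite rE mul0r leNgt D0.
apply: (@le_trans _ _ (r%:E * (tau E b)%:E)%E).
  rewrite -EFinM lee_fin -ler_pdivrMl //; apply: le_tau => T a B dec.
  by rewrite ler_pdivrMl //; exact: main dec.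
by rewrite lee_pmul2l // tau_le_subw.
Qed.

End Widths.

Section Routing.
Variables (R : realType) (V : finType) (E : {set {set V}}).
Hypothesis niso : no_isolated E.

(** The maximal load of [alpha] is positive and at most 1, so the gauge is at most [routing_ratio].
    As the gauge is an infimum, the bound is obtained from values [r] above it. *)
Lemma routing_le_subw (W : {set {set V}}) (alpha : {set {set V}} -> R) D c :
  W \subset E -> (1 < #|W|)%N -> 0 < D -> 0 <= c <= D ->
  (forall p, 0 <= alpha p) ->
  (forall e, e \in E -> incident_weight E alpha e <= 1) ->
  (forall F : {set {set V}}, F \subset E -> balanced W F -> D <= cut_demand E alpha F) ->
  (c%:E / routing_ratio R E <= subw R E)%E.
Proof.
move=> WE W1 D0 /andP[c0 cD] alpha0 inc1 cut.
(* Any tree decomposition provides a balanced [F], whose positive demand forces a nonzero weight. *)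
have [p pE ap] : exists2 p, p \in line_edges E & alpha p != 0.
  have [T [a [bag [dec _]]]] :=
    rooted_decomposition_tree niso (rooted_decomposition_single (leqnn #|E|)).
  have [u [F [FE Fbal _]]] := bag_contains_balanced_boundary dec WE W1.
  have := lt_le_trans D0 (cut F FE Fbal); rewrite /cut_demand => /gt_eqF/negbT.
  apply: contraNP => none; apply/eqP/big1 => p /andP[pE _].
  by have [//|ap] := eqVneq (alpha p) 0; case: none; exists p.
have alphaS : line_weight E alpha by split=> //; exists p.
set gauge := gauge_Sub E (cut_demand E alpha).
pose m := \big[Num.max/0]_(e in E) incident_weight E alpha e.
have m1 : m <= 1.
  by apply: bigmax_le => // e; exact: inc1.
have m0 : 0 < m.
  have := pE; rewrite inE => /exists_inP[e eE /exists_inP[f fE /and3P[/eqP pef _ _]]].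
  apply: (@lt_le_trans _ _ (incident_weight E alpha e)); last first.
    exact: (le_bigmax_cond _ (fun e => incident_weight E alpha e) eE).
  rewrite /incident_weight (bigD1 p) /=; last by rewrite pE pef set21.
  rewrite ltr_wpDr ?sumr_ge0 //.
  by rewrite lt_neqAle eq_sym ap alpha0.
have ratio : (gauge / m%:E <= routing_ratio R E)%E.
  by apply: ereal_sup_ubound; exists alpha.
have gauge0 : (0 <= gauge)%E.
  by apply: le_ereal_inf_tmp => _ [r [r0 _] <-]; rewrite lee_fin.
have gauge_le : (gauge <= routing_ratio R E)%E.
  apply: le_trans ratio; rewrite inver gt_eqF // lee_pemulr // lee_fin.
  by rewrite invf_ge1.
have gaugeP r : (gauge < r%:E)%E -> exists2 r', 0 <= r' <= r & (D%:E <= r'%:E * subw R E)%E.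
  move=> /ereal_inf_lt[_ [r' [r'0 [k kK qk]] <-]]; rewrite lte_fin => r'r.
  exists r'; first by rewrite r'0 ltW.
  exact: (balanced_demand_le_subw niso WE W1 D0 cut r'0 kK qk).
have := subw_ge0 R niso; have := gauge_le.
case: (subw R E) gaugeP => [s||] gaugeP; [|by move=> _ _; exact: leey|by []].
rewrite lee_fin; case: (routing_ratio R E) => [rho||] {}gauge_le s0.
- have Drho : D <= rho * s.
    have [sE|sn0] := eqVneq s 0.
      have [|r' _] := gaugeP (rho + 1).
        by apply: le_lt_trans gauge_le _; rewrite lte_fin ltrDl.
      by rewrite sE mule0 lee_fin leNgt D0.
    have sgt0 : 0 < s by rewrite lt_neqAle eq_sym sn0.
    rewrite leNgt; apply/negP; rewrite -ltr_pdivlMr // => rhoD.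
    (* A factor at most this midpoint is still below [D / s], against [gaugeP]. *)
    pose mid := (rho + D / s) / 2.
    have [|r' /andP[_ r'm]] := gaugeP mid.
      by apply: le_lt_trans gauge_le _; rewrite lte_fin /mid; lra.
    rewrite -EFinM lee_fin -ler_pdivrMr // => Dr'.
    by move: r'm; rewrite /mid; lra.
  have rho0 : 0 < rho.
    rewrite ltNge; apply/negP => rho0.
    by have := mulr_le0_ge0 rho0 s0; lra.
  rewrite inver gt_eqF // -EFinM lee_fin ler_pdivrMr // mulrC.
  exact: le_trans Drho.
- by rewrite invey mule0 lee_fin.
- by have := le_trans gauge0 gauge_le.
Qed.

End Routing.

(** * Choice of parameters and conclusion *)

Lemma size_bound (R : realType) (k : R) : 9 <= k ->
  exists L J : nat, [/\ (2 <= L)%N, (0 < J)%N, (3 * L <= 2 ^ J)%N,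
    (2 * L)%:R <= k & ln 2 / 1728 * (k / ln k) <= L%:R / (288 * J%:R)].
Proof.
(* [L] is the floor of k/2 and [J] the binary logarithm of 3L rounded up. Then 2^J <= 6L <= 3k <=
   k^2, so J ln 2 <= 2 ln k; also k <= 3L. The constant 1728 is 288 times 6. *)
move=> k9; have k2 : 0 <= k / 2 by lra.
move: (Num.truncn _) (truncn_itv k2) => L /andP[Lk kL].
rewrite -[L.+1%:R]natr1 in kL.
have L4 : (4 <= L)%N.
  by rewrite -ltnS -(ltr_nat R) -[L.+1%:R]natr1; lra.
pose J := up_log 2 (3 * L).
have /andP[J1 J2] : (2 ^ J.-1 < 3 * L <= 2 ^ J)%N by apply: up_log_bounds; lia.
have J0 : (0 < J)%N by rewrite lt0n; apply: contraTneq J2 => ->; rewrite expn0; lia.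
exists L, J; split=> //; [lia | by rewrite natrM; lra |].
have lnk : 0 < ln k by rewrite ln_gt0 //; lra.
have JR : 0 < J%:R :> R by rewrite ltr0n.
have Jln : J%:R * ln 2 <= 2 * ln k.
  rewrite -[X in X <= _]mulrC mulr_natr -lnXn // -[2]/(2%:R) mulr_natl -lnXn; last by lra.
  rewrite ler_ln ?posrE ?exprn_gt0 //; last by lra.
  have : (2 ^ J <= 6 * L)%N.
    by rewrite -(prednK J0) expnS; lia.
  rewrite -(ler_nat R) natrX natrM => h; apply: le_trans h _.
  have : 3 * k <= k ^+ 2 by rewrite expr2 ler_pM2r; lra.
  lra.
have kL3 : k <= 3 * L%:R by lra.
have d0 : 0 < 288 * J%:R :> R by rewrite mulr_gt0 ?ltr0n.
rewrite ler_pdivlMr; last exact: d0.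
rewrite [X in X <= _](_ : _ = (J%:R * ln 2) * k / (6 * ln k)); last by field; rewrite gt_eqF.
rewrite ler_pdivrMr ?mulr_gt0 //.
apply: (@le_trans _ _ (2 * ln k * k)); first by rewrite ler_pM2r //; lra.
rewrite (_ : L%:R * _ = 2 * ln k * (3 * L%:R)); last by ring.
by rewrite ler_pM2l // mulr_gt0.
Qed.

Theorem lemma6p2 (R : realType) :
  exists C : R, 0 < C /\
    forall (V : finType) (E : {set {set V}}),
      no_isolated E -> 9 <= ghw R E ->
      (C%:E / routing_ratio R E * (ghw R E / ln (ghw R E))%:E
        <= subw R E)%E.
Proof.
exists (ln 2 / 1728); split; first by rewrite divr_gt0 ?ln_gt0 ?ltr1n ?ltr0n.
move=> V E niso k9; have [L [J [L2 J0 LJ Lk CD]]] := size_bound k9.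
set k := ghw R E in k9 Lk CD *.
have [W [WE WL routed]] : exists W : {set {set V}}, [/\ W \subset E, #|W| = L &
    exists alpha : {set {set V}} -> R, [/\ forall p, 0 <= alpha p,
      forall e, e \in E -> incident_weight E alpha e <= 1 &
      forall F : {set {set V}}, F \subset E -> balanced W F ->
        L%:R / (288 * J%:R) <= cut_demand E alpha F]].
  apply: contrapT => noW.
  (* As L >= 2, 9L <= 8(2L - 1); so separators for every [W] would give ghw <= 2L - 1 < k. *)
  have dec : rooted_decomposition E finset.set0 (2 * L).-1.
    apply: (@rooted_decomposition_separators _ _ L) => //.
    - move=> W WE WL; rewrite -WL in LJ *.
      have [routed|//] := @routing_or_separator R V E W J J0 LJ.
      by exfalso; apply: noW; exists W; split=> //; rewrite -WL.
    - by lia.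
    - exact: finset.sub0set.
    - by rewrite cards0.
  have := ghw_le R niso dec; rewrite -/k leNgt => /negP; apply.
  by apply: lt_le_trans Lk; rewrite ltr_nat; lia.
have [alpha [alpha0 inc cut]] := routed.
have lnk : 0 < ln k by rewrite ln_gt0 //; lra.
rewrite muleAC -EFinM; apply: (routing_le_subw niso WE _ _ _ alpha0 inc cut).
- by rewrite WL.
- rewrite divr_gt0 ?mulr_gt0 ?ltr0n ?J0; by [|lia].
- have ln2 : 0 <= ln 2 :> R by rewrite ln_ge0 ?ler1n.
  have k0 : 0 <= k by lra.
  apply/andP; split; last exact: CD.
  apply: mulr_ge0; last exact: divr_ge0 k0 (ltW lnk).
  by apply: divr_ge0; [exact: ln2 | exact: ler0n].
Qed.
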